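(* The following assertion is false: ''For every integer $m \ge 1$ and every $A \in \mathbb{Z}^{m\times m}$, letting $S_n$ denote the Smith form (over $\mathbb{Z}$) of $A^n$ normalized to have nonnegative diagonal entries, there exists a periodic sequence $(D_n)_{n\in\mathbb{N}} \subset \mathbb{Z}^{m\times m}$ of diagonal matrices such that $S_{n+1} = D_n S_n$ for all $n \in \mathbb{N}$.''
   Context: $\mathbb{N} = \{0,1,2,\dots\}$. A square matrix over $\mathbb{Z}$ is unimodular if its determinant is $\pm 1$. The Smith form of $M \in \mathbb{Z}^{m\times m}$ is the diagonal matrix $S$ with $S_{ii} \mid S_{i+1,i+1}$ for $1 \le i \le m-1$ such that $M = USV$ for some unimodular $U, V \in \mathbb{Z}^{m\times m}$; it is unique once its diagonal entries are required to be nonnegative (zero diagonal entries are allowed). A sequence $(f(n))_{n\in\mathbb{N}}$ is periodic if there exists an integer $T>0$ such that $f(n+T)=f(n)$ for all $n \in \mathbb{N}$. *)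

(* Defs.v *)
From HB Require Import structures.
From mathcomp Require Import all_boot all_order all_algebra.

Set Implicit Arguments.
Unset Strict Implicit.
Unset Printing Implicit Defensive.

Import Order.TTheory GRing.Theory Num.Theory.
Local Open Scope ring_scope.

Definition unimodular (m : nat) (U : 'M[int]_m) : Prop :=
  \det U = 1 \/ \det U = -1.

(* [dvdz] has 0 %| a only for a = 0, so zero diagonal entries come last. *)
Definition smith_form (m : nat) (M S : 'M[int]_m) : Prop :=
  [/\ is_diag_mx S,
      forall i j : 'I_m, j = i.+1 :> nat -> (S i i %| S j j)%Z
    & exists U V : 'M[int]_m,
        [/\ unimodular U, unimodular V & M = U *m S *m V]].

(* The nonnegativity condition makes S unique given M. *)
Definition normalized_smith_form (m : nat) (M S : 'M[int]_m) : Prop :=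
  smith_form M S /\ forall i : 'I_m, 0 <= S i i.

Definition periodic (T : Type) (f : nat -> T) : Prop :=
  exists2 t : nat, (0 < t)%N & forall n : nat, f (n + t)%N = f n.

(* Main.v *)
Require Import Defs.
From HB Require Import structures.
From mathcomp Require Import all_boot all_order all_algebra.

Import Order.TTheory GRing.Theory Num.Theory.
Local Open Scope ring_scope.

(** Let A = [[2, 1], [0, 0]] = E V with E = diag(1, 0) and V = [[2, 1], [1, 0]]
    unimodular.  Since E V E = 2 E, A^(n+1) = 2^n A = (2^n E) V, so the Smith
    forms are S_0 = I and S_(n+1) = diag(2^n, 0).  The upper left entry of D_n
    is therefore 1 for n = 0 and 2 for every n >= 1, which is not periodic. *)

Definition V2 : 'M[int]_2 :=
  \matrix_(i, j) (if i == 0 then if j == 0 then 2 else 1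
                  else if j == 0 then 1 else 0).

Definition E2 : 'M[int]_2 := delta_mx 0 0.

Definition smith_pow (n : nat) : 'M[int]_2 :=
  if n is k.+1 then 2 ^+ k *: E2 else 1%:M.

Lemma unimodular1 (m : nat) : unimodular (1%:M : 'M[int]_m).
Proof. by left; rewrite det1. Qed.

Lemma unimodular_V2 : unimodular V2.
Proof.
(* The last row of [V2] is (1, 0), so a single cofactor survives and the determinant is -1. *)
right; rewrite (expand_det_row _ ord_max) !big_ord_recl big_ord0 /cofactor.
by rewrite !det_mx11 !mxE.
Qed.

(** Sandwiching between the matrix unit [E2] keeps only the upper left entry of [V2], which is 2. *)
Lemma E2_V2_E2 : E2 *m V2 *m E2 = 2 *: E2.
Proof.
apply/matrixP=> i j; rewrite /E2 !mxE !big_ord_recl !big_ord0 /=.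
rewrite !mxE !big_ord_recl !big_ord0 /= !mxE.
by case: i => [[|[|i]] //= ?]; case: j => [[|[|j]] //= ?].
Qed.

Lemma expr_E2_V2 (n : nat) :
  (E2 *m V2 : 'M[int]_2) ^+ n.+1 = 2 ^+ n *: (E2 *m V2).
Proof.
elim: n => [|n IHn]; first by rewrite expr1 expr0 scale1r.
rewrite exprSr IHn -[_ * _]/(_ *m _) -scalemxAl mulmxA E2_V2_E2 -scalemxAl.
by rewrite scalerA -exprSr.
Qed.

Lemma smith_powP (n : nat) :
  normalized_smith_form ((E2 *m V2 : 'M[int]_2) ^+ n) (smith_pow n).
Proof.
case: n => [|n]; split; first split.
- exact: scalar_mx_is_diag.
- by move=> i j _; rewrite !mxE !eqxx.
- exists 1%:M, 1%:M; split; try exact: unimodular1.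
  by rewrite expr0 !mulmx1.
- by move=> i; rewrite mxE eqxx.
- split.
  + apply/is_diag_mxP=> i j; rewrite !mxE.
    by case: i => [[|[|i]] //= ?]; case: j => [[|[|j]] //= ?] _; rewrite mulr0.
  (* A successor index is nonzero, so the entry to be divided is 0. *)
  + move=> i j ij; have /negPf j0 : j != 0 by rewrite -val_eqE /= ij.
    by rewrite !mxE j0 mulr0 dvdz0.
  + exists 1%:M, V2; split; [exact: unimodular1 | exact: unimodular_V2 |].
    by rewrite mul1mx expr_E2_V2 -scalemxAl.
- by move=> i; rewrite !mxE mulr_ge0 ?exprn_ge0 ?ler0n.
Qed.

(** Since [0.-1 = 0], one formula covers both [n = 0] and [n = 1], where the entry is 1. *)
Lemma smith_pow00 (n : nat) : smith_pow n 0 0 = 2 ^+ n.-1.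
Proof. by case: n => [|n]; rewrite !mxE !eqxx ?mulr1. Qed.

Lemma mul_diag_mxE (R : pzSemiRingType) (m : nat) (D M : 'M[R]_m) (i j : 'I_m) :
  is_diag_mx D -> (D *m M) i j = D i i * M i j.
Proof.
move/is_diag_mxP=> diagD; rewrite mxE (bigD1 i) //= big1 ?addr0 // => k ki.
by rewrite diagD ?mul0r // eq_sym.
Qed.

Theorem proposition1p2 :
  ~ (forall (m : nat) (A : 'M[int]_m) (S : nat -> 'M[int]_m),
      (1 <= m)%N ->
      (forall n : nat, normalized_smith_form (A ^+ n) (S n)) ->
      exists D : nat -> 'M[int]_m,
        [/\ periodic D,
            forall n : nat, is_diag_mx (D n)
          & forall n : nat, S n.+1 = D n *m S n]).
Proof.
move=> /(_ 2 (E2 *m V2) smith_pow isT smith_powP) [D [[t t0 perD] diagD SD]].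
have D00 n : 2 ^+ n = D n 0 0 * 2 ^+ n.-1.
  by rewrite -(smith_pow00 n) -mul_diag_mxE // -SD smith_pow00.
(* Periodicity carries the value 1 from index 0 to index [t]. *)
have := D00 0%N; rewrite -(perD 0%N) add0n expr0 mulr1 => Dt.
case: t t0 {perD} Dt => // t _ Dt.
(* The period is positive, so at this index the power of 2 really doubles; a factor 1 would force
   [(2 - 1) * 2 ^+ t = 0]. *)
have := D00 t.+1; rewrite -Dt mul1r exprS => /eqP.
by rewrite -subr_eq0 -[X in _ - X]mul1r -mulrBl mulf_eq0 expf_eq0 andbF.
Qed.
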